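(* Let $G$ be a connected simple graph with $V(G)=\{1,\dots,n\}$ and $E(G)=\{e_1,\dots,e_m\}$. Let $r_i$ ($i=1,\dots,n$), $s_j$ ($j=1,\dots,m$), and $a_e\le b_e$, $c_e\le d_e$ ($e\in E(G)$) be integers. Then there exist integers $a_e\le x_e\le b_e$, $c_e\le y_e\le d_e$ ($e\in E(G)$) such that $$\sum_{i=1}^n r_if_i+\sum_{j=1}^m s_jg_j=\sum_{e\in E(G)}x_ez(e)+\sum_{e\in E(G)}y_ez'(e)$$ if and only if the following hold: (1) if $(t_1,\dots,t_n)^T=N_0(s_1,\dots,s_m)^T+(r_1,\dots,r_n)^T$, then each $t_i$ is even and $\sum_{i=1}^n t_i=0$; (2) for all sets $\emptyset\ne I\subsetneq\{1,\dots,n\}$ and $J\subset E(I)$ such that the induced subgraphs of $G$ on $I$ and on $\{1,\dots,n\}\setminus I$ are connected, $$\sum_{i\in I}r_i+\sum_{e_k\in E(I)\setminus J}s_k-\sum_{e_k\in J}s_k\le 2\!\!\sum_{e=ij\notin J,\ i<j,\ i\in I,\ j\notin I}\!\! b_e-2\!\!\sum_{e=ij\in J,\ i<j,\ i\notin I,\ j\in I}\!\! a_e+2\!\!\sum_{e=ij\notin J,\ i<j,\ i\notin I,\ j\in I}\!\! d_e-2\!\!\sum_{e=ij\in J,\ i<j,\ i\in I,\ j\notin I}\!\! c_e;$$ (3) for all edges $e=e_k\in E(G)$ such that $G-e_k$ is connected, $a_e+c_e\le s_k\le b_e+d_e$.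
   Context: $f_1,\dots,f_n,g_1,\dots,g_m$ is the standard basis of $\mathbb{Z}^n\oplus\mathbb{Z}^m$. For each edge $e=e_k=ij$ with $i<j$, $z(e)=f_i-f_j+g_k$ and $z'(e)=-f_i+f_j+g_k$. For $I\subset\{1,\dots,n\}$, $E(I)$ is the set of edges with exactly one end in $I$. $N_0$ is the $n\times m$ directed incidence matrix of the orientation $D_0$ of $G$ in which each edge $ij$ is oriented with the smaller of $i,j$ as tail: $(N_0)_{ik}=1$ if $i$ is the tail of $e_k$, $-1$ if $i$ is its head, $0$ otherwise. *)

(* Defs.v *)
From HB Require Import structures.
From mathcomp Require Import all_boot all_order all_algebra.
Set Implicit Arguments.
Unset Strict Implicit.
Unset Printing Implicit Defensive.
Import Order.TTheory GRing.Theory Num.Theory.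
Local Open Scope ring_scope.

Definition simple_graph (T : finType) (G : rel T) : Prop :=
  symmetric G /\ irreflexive G.

(* Nonemptiness of the vertex set is not required; this only matters for the
   graph with no vertices. *)
Definition connected_graph (T : finType) (G : rel T) : Prop :=
  forall u v : T, connect G u v.

Definition induced (T : finType) (G : rel T) (I : {set T}) :
    rel {u : T | u \in I} :=
  [rel u v | G (val u) (val v)].
Arguments induced {T} G I.

(* The numbering e_1, ..., e_m of the edges: e k is the pair (i, j) with i < j
   of the two ends of the k-th edge, so its first component is the tail of that
   edge in D_0 and its second component the head. Sets of edges and families
   indexed by edges are taken over the indices k : 'I_m. *)
Definition edge_numbering (n m : nat) (G : rel 'I_n)
    (e : 'I_m -> 'I_n * 'I_n) : Prop :=
  injective e /\
  forall i j : 'I_n, ((i, j) \in codom e) = (i < j)%N && G i j.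

Definition del_edge (n : nat) (G : rel 'I_n) (p : 'I_n * 'I_n) : rel 'I_n :=
  [rel u v | G u v && ([set u; v] != [set p.1; p.2])].

(* Z^n (+) Z^m is 'rV[int]_(n + m). *)
Definition f (n m : nat) (i : 'I_n) : 'rV[int]_(n + m) :=
  delta_mx 0 (lshift m i).

Definition g (n m : nat) (k : 'I_m) : 'rV[int]_(n + m) :=
  delta_mx 0 (rshift n k).

Definition z (n m : nat) (e : 'I_m -> 'I_n * 'I_n) (k : 'I_m) :
    'rV[int]_(n + m) :=
  f m (e k).1 - f m (e k).2 + g n k.

Definition z' (n m : nat) (e : 'I_m -> 'I_n * 'I_n) (k : 'I_m) :
    'rV[int]_(n + m) :=
  - f m (e k).1 + f m (e k).2 + g n k.

Definition cut (n m : nat) (e : 'I_m -> 'I_n * 'I_n) (I : {set 'I_n}) :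
    {set 'I_m} :=
  [set k | ((e k).1 \in I) (+) ((e k).2 \in I)].

Definition N0 (n m : nat) (e : 'I_m -> 'I_n * 'I_n) : 'M[int]_(n, m) :=
  \matrix_(i, k)
    (if i == (e k).1 then 1 else if i == (e k).2 then -1 else 0).

(* Main.v *)
(** Reading off coordinates, the equation says [s = x + y] and
    [r = N0 (x - y)], that is [2 N0 x = N0 s + r = t] with
    [max (a, s - d) <= x <= min (b, s - c)]. So [x] is an integral flow with
    prescribed net outflow [t / 2] and capacities [l <= x <= u], which exists
    iff every vertex set [I] satisfies Hoffman's cut condition; condition (2)
    for [I] and all [J] is that condition, [J] selecting which of the two terms
    attains each min or max. Sufficiency of the cut condition follows by
    augmenting along residual paths. Both sides of the cut condition are
    additive when [I] or its complement splits into parts with no edge in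
    between, which reduces it to connected sides by induction on the number of
    crossing edges. Finally [l <= u] on a bridge, where condition (3) says
    nothing, is the sum of the cut conditions of its two sides. *)
Require Import Defs.
From HB Require Import structures.
From mathcomp Require Import all_boot all_order all_algebra.
From mathcomp Require Import zify ring.
Set Implicit Arguments.
Unset Strict Implicit.
Unset Printing Implicit Defensive.
Import Order.TTheory GRing.Theory Num.Theory.
Local Open Scope ring_scope.

(** * Integral flows with prescribed net outflow: Hoffman's theorem *)

Section Flow.
Variables (V K : finType) (e : K -> V * V).
Implicit Types (I : {set V}) (x l u : K -> int) (tau : V -> int).

Definition outflow x (i : V) : int :=
  \sum_k ((i == (e k).1)%:R - (i == (e k).2)%:R) * x k.

(** The bound in Hoffman's condition; for [l = u = x] it is the net flow of [x] out of [I]. *)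
Definition cut_capacity l u I : int :=
  \sum_(k | ((e k).1 \in I) && ((e k).2 \notin I)) u k
  - \sum_(k | ((e k).1 \notin I) && ((e k).2 \in I)) l k.

Lemma cut_capacityE l u I : cut_capacity l u I =
  \sum_k (if ((e k).1 \in I) && ((e k).2 \notin I) then u k
          else if ((e k).1 \notin I) && ((e k).2 \in I) then - l k else 0).
Proof.
rewrite /cut_capacity [X in X - _]big_mkcond [X in _ - X]big_mkcond -sumrB.
apply: eq_bigr => k _.
by case: (_ \in I); case: (_ \in I); rewrite /= ?subr0 ?sub0r.
Qed.

Definition crossing I : {set K} := [set k | ((e k).1 \in I) (+) ((e k).2 \in I)].

Lemma sum_indicator I (j : V) : \sum_(i in I) (i == j)%:R = (j \in I)%:R :> int.
Proof.
case: (boolP (j \in I)) => jI.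
  rewrite (bigD1 j) //= eqxx big1 ?addr0 // => i /andP[_ /negbTE->] //.
by rewrite big1 // => i iI; case: eqVneq => // ij; rewrite -ij iI in jI.
Qed.

Lemma sum_outflow x I :
  \sum_(i in I) outflow x i =
  \sum_k (((e k).1 \in I)%:R - ((e k).2 \in I)%:R) * x k.
Proof.
rewrite exchange_big; apply: eq_bigr => k _.
by rewrite -mulr_suml sumrB !sum_indicator.
Qed.

Lemma sum_outflow_all x : \sum_i outflow x i = 0.
Proof.
have := sum_outflow x setT; under eq_bigl => i do rewrite inE.
by move=> ->; rewrite big1 // => k _; rewrite !inE subrr mul0r.
Qed.

Lemma sum_outflow_cut x I : \sum_(i in I) outflow x i = cut_capacity x x I.
Proof.
rewrite sum_outflow cut_capacityE; apply: eq_bigr => k _.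
by case: (_ \in I); case: (_ \in I) => /=; ring.
Qed.

Definition residual l u x : rel V := [rel i j | [exists k,
  ((e k == (i, j)) && (x k < u k)) || ((e k == (j, i)) && (l k < x k))]].

Definition push x (k : K) (eps : int) : K -> int :=
  fun k' => x k' + (k' == k)%:R * eps.

Lemma outflow_push x k eps i :
  outflow (push x k eps) i =
  outflow x i + ((i == (e k).1)%:R - (i == (e k).2)%:R) * eps.
Proof.
rewrite /outflow /push; under eq_bigr => k' _ do rewrite mulrDr.
rewrite big_split /=; congr (_ + _).
rewrite (bigD1 k) //= eqxx mul1r big1 ?addr0 // => k' /negbTE->.
by rewrite mul0r mulr0.
Qed.

(* Uniqueness of the vertices on the path guarantees that pushing a unit along
   its first arc, which is incident to [i], leaves the remaining arcs residual. *)
Lemma augment l u x i p :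
  (forall k, l k <= x k <= u k) -> path (residual l u x) i p -> uniq (i :: p) ->
  exists2 x', forall k, l k <= x' k <= u k &
    forall v, outflow x' v = outflow x v + (v == i)%:R - (v == last i p)%:R.
Proof.
elim: p x i => [|j p IHp] x i bx /=.
  by exists x => // v; rewrite addrK.
case/andP=> /existsP[k Hk] path_p /andP[i_notin uniq_p].
have [x1 [bx1 x1k x1out]]: exists x1, [/\ forall k, l k <= x1 k <= u k,
    forall k', x1 k' = x k' \/ k' = k &
    forall v, outflow x1 v = outflow x v + (v == i)%:R - (v == j)%:R].
  have := bx k; case/orP: Hk => /andP[/eqP ek bk] /andP[lk uk].
    exists (push x k 1); split=> [k'|k'|v].
    - by rewrite /push; have := bx k'; case: eqVneq => [->|_]; lia.
    - by rewrite /push; case: eqVneq => [->|_]; [right|left; rewrite mul0r addr0].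
    - by rewrite outflow_push ek /=; ring.
  exists (push x k (-1)); split=> [k'|k'|v].
  - by rewrite /push; have := bx k'; case: eqVneq => [->|_]; lia.
  - by rewrite /push; case: eqVneq => [->|_]; [right|left; rewrite mul0r addr0].
  - by rewrite outflow_push ek /=; ring.
have path_p1 : path (residual l u x1) j p.
  apply: (sub_in_path (P := [in j :: p])) path_p; last exact/allP.
  move=> v w vp wp /existsP[k' Hk']; apply/existsP; exists k'.
  case: (x1k k') => [->//|kk']; rewrite kk' in Hk'; case/negP: i_notin.
  have : i \in [:: v; w].
    by case/orP: Hk => /andP[/eqP ek _]; case/orP: Hk' => /andP[];
       rewrite ek => /eqP[<- <-] _; rewrite !inE eqxx ?orbT.
  by rewrite !inE => /orP[]/eqP->.
have [x' bx' x'out] := IHp x1 j bx1 path_p1 uniq_p.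
by exists x' => // v; rewrite x'out x1out; ring.
Qed.

(** An edge leaving [I] below its upper bound, or entering [I] above its lower bound, would give a
    residual arc out of [I]. *)
Lemma residual_closed_saturated l u x I :
  (forall k, l k <= x k <= u k) ->
  (forall v w, v \in I -> residual l u x v w -> w \in I) ->
  cut_capacity x x I = cut_capacity l u I.
Proof.
move=> bx clI; congr (_ - _); apply: eq_bigr => k /andP[]; have := bx k.
  move=> bk e1 e2; apply/eqP; rewrite eq_le; case/andP: bk => _ -> /=.
  rewrite leNgt; apply: contra e2 => xu; apply: (clI (e k).1) => //.
  by apply/existsP; exists k; rewrite xu -surjective_pairing eqxx.
move=> bk e1 e2; apply/eqP; rewrite eq_le; case/andP: bk => -> _.
rewrite andbT leNgt; apply: contra e1 => xu; apply: (clI (e k).2) => //.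
by apply/existsP; exists k; rewrite xu -surjective_pairing eqxx orbT.
Qed.

(** Starting from [l], unit augmentations decrease the total defect [\sum_i |tau i - outflow x i|],
    so the induction is on a bound for it. *)
Lemma feasible_flow l u tau :
  (forall k, l k <= u k) -> \sum_i tau i = 0 ->
  (forall I, \sum_(i in I) tau i <= cut_capacity l u I) ->
  exists2 x, forall k, l k <= x k <= u k & forall i, outflow x i = tau i.
Proof.
move=> le_lu tau0 cutP.
suff ind N x : (forall k, l k <= x k <= u k) ->
    (\sum_i `|(tau i - outflow x i)%R| < N)%N ->
    exists2 x, forall k, l k <= x k <= u k & forall i, outflow x i = tau i.
  by apply: (ind _ l _ (ltnSn _)) => k; rewrite lexx le_lu.
elim: N x => // N IHN x bx ltN.
pose w i := tau i - outflow x i.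
have w0 : \sum_i w i = 0 by rewrite sumrB tau0 sum_outflow_all subrr.
(* The defects [w] sum to zero, so if none is positive, all vanish and [x] is the required flow. *)
case: (pickP (fun i => 0 < w i)) => [i wi|w_le0]; last first.
  have wN i : 0 <= - w i by rewrite oppr_ge0 leNgt w_le0.
  exists x => // i; apply/eqP; rewrite eq_sym -subr_eq0 -oppr_eq0 -/(w i).
  have /eqP : \sum_i - w i = 0 by rewrite sumrN w0 oppr0.
  by rewrite psumr_eq0 // => /allP/(_ i)/(_ (mem_index_enum i)).
case: (pickP (fun j => connect (residual l u x) i j && (w j < 0))) => [j|noj].
  case/andP=> /connectP[p0 path_p0 ->] {j}.
  case: (shortenP path_p0) => p path_p uniq_p _ wj.
  have [x' bx' x'out] := augment bx path_p uniq_p.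
  set j := last i p in x'out wj.
  apply: (IHN x' bx').
  have ij : i != j by apply/eqP => ij; move: wi wj; rewrite -ij; lia.
  rewrite ltnS in ltN; apply: leq_trans ltN.
  (* The term at [i] strictly decreases; the term at [j] does not grow because [w j < 0]; the others
     are unchanged. *)
  rewrite (bigD1 i) // [leqRHS](bigD1 i) //=.
  rewrite -addSn leq_add //.
    rewrite x'out eqxx (negbTE ij); move: wi; rewrite /w; lia.
  apply: leq_sum => v vi; rewrite x'out (negbTE vi).
  by case: eqVneq => [->|_]; move: wj; rewrite /w; lia.
(* If no vertex of negative defect is reachable from [i], the reachable set [I] is saturated. Its
   defects are nonnegative and [w i > 0], so [tau] sums over [I] to more than the capacity, against
   [cutP]. *)
have := cutP [set j | connect (residual l u x) i j].
set I := [set j | _].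
rewrite -(residual_closed_saturated bx) => [|v v']; last first.
  by rewrite !inE => iv vv'; apply: connect_trans iv (connect1 vv').
rewrite -sum_outflow_cut -subr_le0 -sumrB (bigD1 i) ?inE ?connect0 //=.
have : 0 <= \sum_(j in I | j != i) w j.
  apply: sumr_ge0 => j /andP[]; rewrite inE => ij _.
  by have := noj j; rewrite ij /= leNgt => ->.
by move=> wI; rewrite leNgt (ltr_pwDl wi wI).
Qed.

End Flow.

(** * Reduction of the cut condition to sets with connected sides *)

Lemma not_connected_split (V : finType) (G : rel V) (I : {set V}) :
  ~~ [forall u, forall v, connect (induced G I) u v] ->
  exists2 A : {set V}, A \subset I & [/\ A != set0, I :\: A != set0 &
    forall v w, v \in A -> w \in I :\: A -> ~~ G v w].
Proof.
case/forallPn=> u /forallPn[v uv].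
exists [set val w | w in connect (induced G I) u].
  by apply/subsetP => _ /imsetP[w _ ->]; exact: valP.
split.
- by apply/set0Pn; exists (val u); apply: imset_f; rewrite inE.
- apply/set0Pn; exists (val v); rewrite inE (valP v) andbT.
  by rewrite mem_imset; [|exact: val_inj].
- move=> _ w /imsetP[v' uv' ->] /setDP[wI]; apply: contra => v'w.
  apply/imsetP; exists (exist _ w wI) => //.
  by apply: connect_trans uv' (connect1 _).
Qed.

Lemma sum_setC (V : finType) (tau : V -> int) (A : {set V}) :
  \sum_i tau i = 0 -> \sum_(i in ~: A) tau i = - \sum_(i in A) tau i.
Proof.
rewrite (bigID [in A]) /= => /eqP; rewrite addrC addr_eq0 => /eqP<-.
by apply: eq_bigl => i; rewrite inE.
Qed.

Section CutReduction.
Variables (V K : finType) (G : rel V) (e : K -> V * V).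
Hypothesis G_sym : symmetric G.
Hypothesis G_conn : connected_graph G.
Hypothesis e_edge : forall k, G (e k).1 (e k).2.
Hypothesis edge_e : forall i j, G i j -> exists k, e k = (i, j) \/ e k = (j, i).

(** A set that no edge crosses is closed under adjacency. This makes the crossing number of each
    part drop strictly when a cut is split into two. *)
Lemma crossing_neq0 (I : {set V}) :
  I != set0 -> I != setT -> crossing e I != set0.
Proof.
case/set0Pn=> u uI; rewrite -subTset => /subsetPn[v _ vI].
apply/negP => /eqP cr0; case/negP: vI.
suff clI : closed G [in I] by rewrite -(closed_connect clI (G_conn u v)).
move=> i j ij; have [k ek] := edge_e ij.
have : k \notin crossing e I by rewrite cr0 inE.
by rewrite inE; case: ek => -> /=; case: (i \in I); case: (j \in I).
Qed.

Lemma cut_condition_connected (l u : K -> int) (tau : V -> int) :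
  \sum_i tau i = 0 ->
  (forall I : {set V}, I != set0 -> I != setT ->
    connected_graph (induced G I) -> connected_graph (induced G (~: I)) ->
    \sum_(i in I) tau i <= cut_capacity e l u I) ->
  forall I : {set V}, \sum_(i in I) tau i <= cut_capacity e l u I.
Proof.
move=> tau0 connP I.
have tauC A := sum_setC A tau0.
have [N] := ubnP #|crossing e I|; elim: N I => // N IHN I ltN.
have [->|I0] := eqVneq I set0.
  by rewrite /cut_capacity !big_pred0 // => k; rewrite !inE ?andbF.
have [->|IT] := eqVneq I setT.
  rewrite (eq_bigl predT) ?tau0 => [|i]; last by rewrite inE.
  by rewrite /cut_capacity !big_pred0 // => k; rewrite !inE.
(* The hypothesis on edges says that those leaving [I] are the disjoint union of those leaving [P]
   and those leaving [Q], and likewise for entering edges. Capacities then add up, and the induction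
   hypothesis applies to both parts. *)
have split (P Q : {set V}) :
    P != set0 -> P != setT -> Q != set0 -> Q != setT ->
    \sum_(i in I) tau i = \sum_(i in P) tau i + \sum_(i in Q) tau i ->
    (forall k, let: (i, j) := e k in
       [&& (i \in I) && (j \notin I) ==
           ((i \in P) && (j \notin P)) || ((i \in Q) && (j \notin Q)),
           (j \in I) && (i \notin I) ==
           ((j \in P) && (i \notin P)) || ((j \in Q) && (i \notin Q)) &
           ~~ (((i \in P) (+) (j \in P)) && ((i \in Q) (+) (j \in Q)))]) ->
    \sum_(i in I) tau i <= cut_capacity e l u I.
  move=> P0 PT Q0 QT -> crP.
  have crU : crossing e I = crossing e P :|: crossing e Q.
    apply/setP => k; rewrite !inE; have := crP k; case: (e k) => i j /=.
    by case: (i \in I); case: (j \in I); case: (i \in P); case: (j \in P);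
       case: (i \in Q); case: (j \in Q).
  have crI : crossing e P :&: crossing e Q = set0.
    apply/setP => k; rewrite !inE; have := crP k; case: (e k) => i j /=.
    by case: (i \in I); case: (j \in I); case: (i \in P); case: (j \in P);
       case: (i \in Q); case: (j \in Q).
  have := cardsUI (crossing e P) (crossing e Q); rewrite -crU crI cards0 addn0.
  move: (crossing_neq0 P0 PT) (crossing_neq0 Q0 QT); rewrite -!card_gt0 => cP cQ cE.
  have -> : cut_capacity e l u I = cut_capacity e l u P + cut_capacity e l u Q.
    rewrite !cut_capacityE -big_split; apply: eq_bigr => k _ /=.
    have := crP k; case: (e k) => i j /=.
    by case: (i \in I); case: (j \in I); case: (i \in P); case: (j \in P);
       case: (i \in Q); case: (j \in Q); rewrite //= ?addr0 ?add0r.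
  by apply: lerD; apply: IHN; lia.
have noedge (A B : {set V}) : (forall v w, v \in A -> w \in B -> ~~ G v w) -> forall k,
    let: (i, j) := e k in ~~ (((i \in A) && (j \in B)) || ((i \in B) && (j \in A))).
  move=> nG k; have := e_edge k; case: (e k) => i j /= ij.
  apply/negP => /orP[]/andP[iA jB].
    by have := nG i j iA jB; rewrite ij.
  by have := nG j i jB iA; rewrite G_sym ij.
have subNT (A B : {set V}) : A \subset B -> B != setT -> A != setT.
  by move=> AB; rewrite -!subTset; apply: contra => /subset_trans->.
have C0 (A : {set V}) : (~: A != set0) = (A != setT).
  by rewrite -setCT (inj_eq (@setC_inj _)).
have CT (A : {set V}) : (~: A != setT) = (A != set0).
  by rewrite -setC0 (inj_eq (@setC_inj _)).
have [/forallP cI|/not_connected_split[A AI [A0 B0 nG]]] :=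
    boolP [forall u, forall v, connect (induced G I) u v]; last first.
  apply: (split A (I :\: A)) => //.
  - exact: subNT IT.
  - exact: subNT (subsetDl _ _) IT.
  - by rewrite (big_setID A) (setIidPr AI).
  move=> k; have := noedge _ _ nG k; case: (e k) => i j /=.
  have iA : (i \in A) ==> (i \in I) by apply/implyP; apply: subsetP.
  have jA : (j \in A) ==> (j \in I) by apply/implyP; apply: subsetP.
  move: iA jA; rewrite !inE.
  by case: (i \in I); case: (j \in I); case: (i \in A); case: (j \in A).
have [/forallP cCI|/not_connected_split[A AI [A0 B0 nG]]] :=
    boolP [forall u, forall v, connect (induced G (~: I)) u v].
  by apply: connP => // v w; [exact/forallP/cI | exact/forallP/cCI].
have CI : ~: I != setT by rewrite CT.
(* When [~: I] falls into [A] and [B], the cut is split along the complements of [A] and [B]: an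
   edge leaves [I] exactly when it enters [A] or [B] from outside. The sums of [tau] match since its
   total is zero. *)
apply: (split (~: A) (~: (~: I :\: A))); rewrite ?C0 ?CT //.
- exact: subNT CI.
- exact: subNT (subsetDl _ _) CI.
- by rewrite -{1}[I]setCK tauC (big_setID A) /= (setIidPr AI) opprD !tauC.
move=> k; have := noedge _ _ nG k; case: (e k) => i j /=.
have iA : (i \in A) ==> (i \in ~: I) by apply/implyP; apply: subsetP.
have jA : (j \in A) ==> (j \in ~: I) by apply/implyP; apply: subsetP.
move: iA jA; rewrite !inE.
by case: (i \in I); case: (j \in I); case: (i \in A); case: (j \in A).
Qed.

End CutReduction.

Lemma set2_inj (T : finType) (x y v w : T) :
  x != y -> [set x; y] = [set v; w] -> (x, y) = (v, w) \/ (x, y) = (w, v).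
Proof.
move=> xy eqs; have := set21 x y; have := set22 x y; rewrite eqs !inE.
by move=> /orP[] /eqP yE /orP[] /eqP xE; move: xy; rewrite xE yE ?eqxx //; auto.
Qed.

(** * Bridges, coordinates and the form of condition (2) *)

Section Zonotope.
Variables (n m : nat) (G : rel 'I_n) (e : 'I_m -> 'I_n * 'I_n).
Hypotheses (G_simple : simple_graph G) (G_conn : connected_graph G).
Hypothesis e_num : edge_numbering G e.

Lemma edge_lt k : ((e k).1 < (e k).2)%N && G (e k).1 (e k).2.
Proof. by rewrite -(proj2 e_num) -surjective_pairing codom_f. Qed.

Lemma edge_neq k : (e k).1 != (e k).2.
Proof. by have /andP[] := edge_lt k; rewrite ltn_neqAle => /andP[]. Qed.

Lemma edge_index i j : G i j -> exists k, e k = (i, j) \/ e k = (j, i).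
Proof.
move=> ij; have [lt_ij|lt_ji|/val_inj eq_ij] := ltngtP i j.
- have /codomP[k ek] : (i, j) \in codom e by rewrite (proj2 e_num) lt_ij.
  by exists k; left.
- have /codomP[k ek] : (j, i) \in codom e.
    by rewrite (proj2 e_num) lt_ji (proj1 G_simple).
  by exists k; right.
- by rewrite eq_ij (proj2 G_simple) in ij.
Qed.

(** [I] is the component of the tail after deletion of the edge. If it contained the head, the
    deleted edge could be bypassed and the graph would stay connected. *)
Lemma bridge_crossing k :
  ~~ [forall u, forall v, connect (del_edge G (e k)) u v] ->
  exists I : {set 'I_n},
    [/\ (e k).1 \in I, (e k).2 \notin I & crossing e I = [set k]].
Proof.
set D := del_edge G (e k) => ncD.
have D_sym : connect_sym D.
  apply: sym_connect_sym => u v.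
  by rewrite /D /del_edge /= (proj1 G_simple) [[set v; u]]setUC.
have Dedge u v : G u v -> [set u; v] != [set (e k).1; (e k).2] -> connect D u v.
  by move=> uv nuv; apply: connect1; rewrite /D /del_edge /= uv.
have not12 : ~~ connect D (e k).1 (e k).2.
  apply: contra ncD => c12; apply/forallP => u; apply/forallP => v.
  apply: connect_sub (G_conn u v) => i j ij.
  have ne_ij : i != j by apply/eqP => eij; rewrite eij (proj2 G_simple) in ij.
  have [/(set2_inj ne_ij)[]|] := eqVneq [set i; j] [set (e k).1; (e k).2].
  - by case=> -> ->.
  - by case=> -> ->; rewrite D_sym.
  - exact: Dedge.
exists [set v | connect D (e k).1 v]; split; rewrite ?inE //.
apply/setP => k'; rewrite !inE; apply/idP/eqP => [|->]; last first.
  by rewrite connect0 (negbTE not12).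
have /andP[lt_k' G_k'] := edge_lt k'.
have [/(set2_inj (edge_neq k'))[]|nk' ] :=
    eqVneq [set (e k').1; (e k').2] [set (e k).1; (e k).2].
- by rewrite -!surjective_pairing => /(proj1 e_num).
(* The reversed pair of ends contradicts the ordering of tail and head. *)
- case=> e1 e2; have /andP[] := edge_lt k.
  by rewrite -e1 -e2 ltnNge (ltnW lt_k').
- by rewrite (same_connect_r D_sym (Dedge _ _ G_k' nk')) addbb.
Qed.

Lemma outflow_N0 (x : 'I_m -> int) (r : 'I_n -> int) i :
  (N0 e *m (\col_k x k) + \col_i r i) i 0 = outflow e x i + r i.
Proof.
rewrite !mxE; congr (_ + _); apply: eq_bigr => k _; rewrite !mxE.
case: (eqVneq i (e k).1) => [->|_]; first by rewrite (negbTE (edge_neq k)) subr0.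
by case: eqVneq; rewrite ?subr0 ?sub0r.
Qed.

(** [z] and [z'] have opposite vertex parts and the same edge part, so the vertex coordinates see
    [x - y] and the edge coordinates [x + y]. *)
Lemma combination_coordinates (r : 'I_n -> int) (s x y : 'I_m -> int) :
  \sum_i r i *: f m i + \sum_k s k *: g n k =
    \sum_k x k *: z e k + \sum_k y k *: z' e k <->
  (forall i, r i = outflow e (fun k => x k - y k) i) /\
  (forall k, s k = x k + y k).
Proof.
have addE (u v : 'rV[int]_(n + m)) j : (u + v) 0 j = u 0 j + v 0 j.
  by rewrite mxE.
have oppE (u : 'rV[int]_(n + m)) j : (- u) 0 j = - u 0 j by rewrite mxE.
have scaleE q (u : 'rV[int]_(n + m)) j : (q *: u) 0 j = q * u 0 j.
  by rewrite mxE.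
have fE i j : f m i 0 (lshift m j) = (j == i)%:R.
  by rewrite mxE eqxx (inj_eq (@lshift_inj _ _)).
have fE0 i k : f m i 0 (rshift n k) = 0 by rewrite mxE eq_shift andbF.
have gE k l : g n k 0 (rshift n l) = (l == k)%:R.
  by rewrite mxE eqxx (inj_eq (@rshift_inj _ _)).
have gE0 k j : g n k 0 (lshift m j) = 0 by rewrite mxE eq_shift andbF.
have sum_delta (T : finType) (F : T -> int) j : \sum_i F i * (j == i)%:R = F j.
  rewrite (bigD1 j) //= eqxx mulr1 big1 ?addr0 // => i.
  by rewrite eq_sym => /negbTE->; rewrite mulr0.
have lhs_l j : (\sum_i r i *: f m i + \sum_k s k *: g n k) 0 (lshift m j) = r j.
  rewrite mxE !summxE; under eq_bigr => i _ do rewrite mxE fE.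
  by rewrite sum_delta big1 ?addr0 // => k _; rewrite mxE gE0 mulr0.
have lhs_r l : (\sum_i r i *: f m i + \sum_k s k *: g n k) 0 (rshift n l) = s l.
  rewrite mxE !summxE addrC; under eq_bigr => k _ do rewrite mxE gE.
  by rewrite sum_delta big1 ?addr0 // => i _; rewrite mxE fE0 mulr0.
have rhs_l j : (\sum_k x k *: z e k + \sum_k y k *: z' e k) 0 (lshift m j) =
    outflow e (fun k => x k - y k) j.
  rewrite mxE !summxE -big_split; apply: eq_bigr => k _ /=.
  rewrite !scaleE /z /z' !(addE, oppE) !fE gE0; ring.
have rhs_r l : (\sum_k x k *: z e k + \sum_k y k *: z' e k) 0 (rshift n l) =
    x l + y l.
  rewrite -[RHS](sum_delta _ (fun k => x k + y k)) mxE !summxE -big_split.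
  apply: eq_bigr => k _ /=.
  rewrite !scaleE /z /z' !(addE, oppE) !fE0 gE; ring.
split=> [eqv|[eq_r eq_s]].
  by split=> i; [rewrite -rhs_l -eqv lhs_l | rewrite -rhs_r -eqv lhs_r].
apply/rowP => i; case: (split_ordP i) => j ->.
  by rewrite lhs_l rhs_l.
by rewrite lhs_r rhs_r.
Qed.

(** With the sums of [s] moved to the right, each crossing edge contributes one term, selected by
    its direction and by membership in [J]; inequalities can then be checked edge by edge. *)
Lemma cut_inequality_sum (s a b c d : 'I_m -> int) (I : {set 'I_n})
    (J : {set 'I_m}) (q : int) :
  J \subset cut e I ->
  (q + \sum_(k in cut e I :\: J) s k - \sum_(k in J) s k
    <= 2 * (\sum_(k | [&& k \notin J, (e k).1 \in I & (e k).2 \notin I]) b k)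
       - 2 * (\sum_(k | [&& k \in J, (e k).1 \notin I & (e k).2 \in I]) a k)
       + 2 * (\sum_(k | [&& k \notin J, (e k).1 \notin I & (e k).2 \in I]) d k)
       - 2 * (\sum_(k | [&& k \in J, (e k).1 \in I & (e k).2 \notin I]) c k))
  = (q <= \sum_k
      (if ((e k).1 \in I) && ((e k).2 \notin I) then
         if k \in J then s k - 2 * c k else 2 * b k - s k
       else if ((e k).1 \notin I) && ((e k).2 \in I) then
         if k \in J then s k - 2 * a k else 2 * d k - s k
       else 0)).
Proof.
move=> JI; rewrite -[LHS]subr_ge0 -[RHS]subr_ge0; congr (0 <= _).
set S := \sum_k _; suff -> : S =
    2 * (\sum_(k | [&& k \notin J, (e k).1 \in I & (e k).2 \notin I]) b k)
    - 2 * (\sum_(k | [&& k \in J, (e k).1 \notin I & (e k).2 \in I]) a k)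
    + 2 * (\sum_(k | [&& k \notin J, (e k).1 \notin I & (e k).2 \in I]) d k)
    - 2 * (\sum_(k | [&& k \in J, (e k).1 \in I & (e k).2 \notin I]) c k)
    - (\sum_(k in cut e I :\: J) s k - \sum_(k in J) s k) by ring.
rewrite !mulr_sumr !(big_mkcond _ s) (big_mkcond _ (fun k => 2 * a k)).
rewrite (big_mkcond _ (fun k => 2 * b k)) (big_mkcond _ (fun k => 2 * c k)).
rewrite (big_mkcond _ (fun k => 2 * d k)) -!sumrB -big_split -!sumrB.
apply: eq_bigr => k _ /=; have : (k \in J) ==> (k \in cut e I).
  by apply/implyP; apply: subsetP.
rewrite !inE; case: (k \in J); case: (_ \in I); case: (_ \in I) => //= _; ring.
Qed.

End Zonotope.

(** * The equivalence *)

Theorem theorem4p11 (n m : nat) (G : rel 'I_n) (e : 'I_m -> 'I_n * 'I_n)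
    (G_simple : simple_graph G) (G_conn : connected_graph G)
    (e_num : edge_numbering G e)
    (r : 'I_n -> int) (s a b c d : 'I_m -> int)
    (le_ab : forall k, a k <= b k) (le_cd : forall k, c k <= d k) :
  (exists x y : 'I_m -> int,
     [/\ forall k, a k <= x k <= b k,
         forall k, c k <= y k <= d k &
         \sum_i r i *: f m i + \sum_k s k *: g n k =
         \sum_k x k *: z e k + \sum_k y k *: z' e k])
  <->
  [/\ forall t : 'cV[int]_n,
        t = N0 e *m (\col_k s k) + \col_i r i ->
        (forall i, (2 %| t i 0%R)%Z) /\ \sum_i t i 0 = 0,
      forall (I : {set 'I_n}) (J : {set 'I_m}),
        I != set0 -> I \proper [set: 'I_n] -> J \subset cut e I ->
        connected_graph (induced G I) ->
        connected_graph (induced G (~: I)) ->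
        \sum_(i in I) r i + \sum_(k in cut e I :\: J) s k
          - \sum_(k in J) s k
        <= 2 * (\sum_(k | [&& k \notin J, (e k).1 \in I & (e k).2 \notin I])
                  b k)
         - 2 * (\sum_(k | [&& k \in J, (e k).1 \notin I & (e k).2 \in I])
                  a k)
         + 2 * (\sum_(k | [&& k \notin J, (e k).1 \notin I & (e k).2 \in I])
                  d k)
         - 2 * (\sum_(k | [&& k \in J, (e k).1 \in I & (e k).2 \notin I])
                  c k) &
      forall k : 'I_m, connected_graph (del_edge G (e k)) ->
        a k + c k <= s k <= b k + d k].
Proof.
split=> [[x [y [bx by_]]]|[cond1 cond2 cond3]].
  case/combination_coordinates => eq_r eq_s.
  have t_eq i : outflow e s i + r i = 2 * outflow e x i.
    rewrite eq_r -big_split mulr_sumr; apply: eq_bigr => k _ /=.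
    by rewrite eq_s; ring.
  split=> [_ ->|I J _ _ JI _ _|k _].
  - split=> [i|]; first by rewrite (outflow_N0 e_num) t_eq dvdz_mulr.
    under eq_bigr => i _ do rewrite (outflow_N0 e_num) t_eq.
    by rewrite -mulr_sumr sum_outflow_all mulr0.
  (* Since [s = x + y], the comparison at each crossing edge is twice one of the four bounds on
     [x k] and [y k]. *)
  - rewrite cut_inequality_sum //; under eq_bigr => i _ do rewrite eq_r.
    rewrite sum_outflow; apply: ler_sum => k _; rewrite eq_s.
    have /andP[? ?] := bx k; have /andP[? ?] := by_ k.
    by case: (_ \in I); case: (_ \in I); case: (k \in J) => /=; lia.
  - by rewrite eq_s; have := bx k; have := by_ k; lia.
pose t (i : 'I_n) : int := outflow e s i + r i.
pose tau i := (t i %/ 2)%Z.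
have [t_even t_sum] := cond1 _ erefl.
have tE i : t i = 2 * tau i.
  by rewrite mulrC divzK // /t -(outflow_N0 e_num) t_even.
have tau0 : \sum_i tau i = 0.
  suff /eqP : 2 * \sum_i tau i = 0 by rewrite mulf_eq0 => /eqP.
  rewrite mulr_sumr -[RHS]t_sum; apply: eq_bigr => i _.
  by rewrite (outflow_N0 e_num) -tE.
pose l k : int := Num.max (a k) (s k - d k).
pose u k : int := Num.min (b k) (s k - c k).
have cutP : forall I : {set 'I_n}, \sum_(i in I) tau i <= cut_capacity e l u I.
  apply: (cut_condition_connected (proj1 G_simple) G_conn) => //.
  - by move=> k; have /andP[] := edge_lt e_num k.
  - exact: (edge_index G_simple e_num).
  move=> I I0 IT cI cCI.
  (* [J] picks the smaller term at each crossing edge: [min (2b - s, s - 2c) = 2u - s] on a leaving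
     edge and [min (2d - s, s - 2a) = s - 2l] on an entering one. *)
  pose J := [set k in cut e I |
    if (e k).1 \in I then s k - c k <= b k else s k - d k <= a k].
  have JI : J \subset cut e I by apply/subsetP => k; rewrite inE => /andP[].
  have := cond2 I J I0; rewrite properT => /(_ IT JI cI cCI).
  rewrite cut_inequality_sum // => leI.
  suff : 2 * \sum_(i in I) tau i <= 2 * cut_capacity e l u I by lia.
  rewrite mulr_sumr; under eq_bigr => i _ do rewrite -tE.
  rewrite big_split /= sum_outflow addrC -lerBrDr; apply: le_trans leI _.
  rewrite cut_capacityE mulr_sumr -sumrB; apply: ler_sum => k _.
  rewrite !inE /l /u; case: (_ \in I); case: (_ \in I) => //=;
    by [case: ifP; lia | lia].
have le_lu k : l k <= u k.
  (* Given [a <= b] and [c <= d], the bounds of condition (3) yield [l <= u]. *)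
  suff : a k + c k <= s k <= b k + d k \/ l k <= u k.
    by case=> //; have := le_ab k; have := le_cd k; rewrite /l /u; lia.
  have [/forallP cD|/(bridge_crossing G_simple G_conn e_num)[I [I1 I2 crI]]] :=
      boolP [forall u, forall v, connect (del_edge G (e k)) u v].
    by left; apply: cond3 => v w; apply/forallP/cD.
  (* Only [k] crosses [I], so the two capacities are [u k] and [- l k], while the sums of [tau]
     cancel. *)
  right; have := lerD (cutP I) (cutP (~: I)).
  have only k' : k' != k -> (e k').1 \in I = ((e k').2 \in I).
    move=> k'k; have : k' \notin crossing e I by rewrite crI inE.
    by rewrite inE; case: (_ \in I); case: (_ \in I).
  rewrite (sum_setC _ tau0) subrr !cut_capacityE -big_split /= (bigD1 k) //= big1 => [|k' /only E].
    by rewrite !inE I1 (negbTE I2) /=; lia.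
  by rewrite !inE E; case: (_ \in I).
have [x bx x_tau] := feasible_flow le_lu tau0 cutP.
exists x, (fun k => s k - x k); split=> [k|k|].
- by have := bx k; rewrite /l /u; lia.
- by have := bx k; rewrite /l /u; lia.
apply/combination_coordinates; split=> [i|k]; last by ring.
(* Adding the outflow of [s] turns both sides into twice the outflow of [x], because
   [s + (x - (s - x)) = 2x]. *)
apply: (addrI (outflow e s i)); rewrite -/(t i) tE -x_tau mulr_sumr -big_split.
by apply: eq_bigr => k _ /=; ring.
Qed.
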